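(* Let $\mathcal{G}=(\mathcal{V},\mathcal{E})$, $\mathcal{V}=\{1,\dots,n\}$, be a tree (connected undirected graph with $|\mathcal{E}|=n-1$), and let $x=(R_1,\dots,R_n)\in SO(3)^n$ satisfy $d(R_i,R_j)<\pi$ for every $(i,j)\in\mathcal{E}$. Whenever $W(x)>0$, $$\sum_{C\in\mathcal{P}_0(x)}\|S_C\|\ \ge\ 2.$$
   Context: $SO(3)$ carries the bi-invariant metric $\langle R\xi^\wedge,R\eta^\wedge\rangle_R=\xi^\top\eta$, where $\xi^\wedge$ is the skew-symmetric matrix with $\xi^\wedge\eta=\xi\times\eta$ and $(\cdot)^\vee$ is the inverse map; $d$ is the geodesic distance, and $d(R,Q)=\|(\log(R^\top Q))^\vee\|$ when $d(R,Q)<\pi$ ($\log$ the principal matrix logarithm). For $(i,j)\in\mathcal{E}$, $e_{ij}:=(\log(R_i^\top R_j))^\vee\in\mathbb{R}^3$. $W(x):=\sum_{(i,j)\in\mathcal{E}}\|e_{ij}\|$ (each undirected edge counted once). For $z\in\mathbb{R}^3$, $\operatorname{sgn}(z):=z/\|z\|$ if $z\ne0$ and $\operatorname{sgn}(0):=0$. $\mathcal{N}_i:=\{j:(i,j)\in\mathcal{E}\}$, $s_i:=\sum_{j\in\mathcal{N}_i}\operatorname{sgn}(e_{ij})$. The zero-error subgraph is $(\mathcal{V},\{(i,j)\in\mathcal{E}:e_{ij}=0\})$; its connected components (subsets of $\mathcal{V}$) are the clusters and form the cluster partition $\mathcal{P}_0(x)$. For a cluster $C$, $S_C:=\sum_{i\in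 C}s_i$. *)

(* Defs.v *)
From HB Require Import structures.
From mathcomp Require Import all_boot all_order all_algebra.
From mathcomp Require Import all_classical all_reals all_analysis.
From mathcomp Require Import complex.

Set Implicit Arguments.
Unset Strict Implicit.
Unset Printing Implicit Defensive.

Import Order.TTheory GRing.Theory Num.Theory.
Import numFieldNormedType.Exports.

Local Open Scope ring_scope.

(* The library norm `|v| on 'cV[R]_3 is the sup norm, hence a separate
   Euclidean norm. *)
Definition enorm (R : realType) (v : 'cV[R]_3) : R :=
  Num.sqrt (\sum_i v i 0 ^+ 2).

Definition crossv (R : realType) (u v : 'cV[R]_3) : 'cV[R]_3 :=
  \col_i [:: u 1 0 * v 2 0 - u 2 0 * v 1 0;
             u 2 0 * v 0 0 - u 0 0 * v 2 0;
             u 0 0 * v 1 0 - u 1 0 * v 0 0]`_i.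

Definition hat (R : realType) (u : 'cV[R]_3) : 'M[R]_3 :=
  \matrix_(i, j) (nth [::] [:: [:: 0; - u 2 0; u 1 0];
                               [:: u 2 0; 0; - u 0 0];
                               [:: - u 1 0; u 0 0; 0]] i)`_j.

(* Total function: it reads off the skew-symmetric part of X, and is the inverse
   of hat on skew-symmetric matrices (hatK, veeK). *)
Definition vee (R : realType) (X : 'M[R]_3) : 'cV[R]_3 :=
  \col_i [:: (X 2 1 - X 1 2) / 2;
             (X 0 2 - X 2 0) / 2;
             (X 1 0 - X 0 1) / 2]`_i.

Lemma hat_mul (R : realType) (u v : 'cV[R]_3) : hat u *m v = crossv u v.
Proof.
apply/matrixP => i j; rewrite ord1 !mxE !big_ord_recl big_ord0 !mxE.
have -> : lift ord0 ord0 = 1 :> 'I_3 by apply/val_inj.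
have -> : lift ord0 (lift ord0 ord0) = 2 :> 'I_3 by apply/val_inj.
have -> : ord0 = 0 :> 'I_3 by [].
case: i => -[|[|[|//]]] /= _; rewrite ?mul0r ?add0r ?addr0 ?mulNr //.
all: exact: addrC.
Qed.

Lemma hatK (R : realType) : cancel (@hat R) (@vee R).
Proof.
move=> u; apply/matrixP => i j; rewrite ord1 !mxE.
by case: i => -[|[|[|//]]] lti /=; rewrite opprK mulrDl -splitr;
  congr (u _ _); apply/val_inj.
Qed.

Lemma veeK (R : realType) (X : 'M[R]_3) : X^T = - X -> hat (vee X) = X.
Proof.
move=> skewX.
have XN i j : X j i = - X i j by move/matrixP/(_ i j): skewX; rewrite !mxE.
have X0 i : X i i = 0.
  by move/eqP: (XN i i); rewrite -addr_eq0 -mulr2n mulrn_eq0 => /eqP.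
have half i j : (X i j - X j i) / 2 = X i j.
  by rewrite (XN i j) opprK mulrDl -splitr.
apply/matrixP => i j; rewrite !mxE.
case: i => -[|[|[|//]]] lti; case: j => -[|[|[|//]]] ltj /=; rewrite -?mulNr ?opprB ?half.
all: by rewrite -1?(X0 (Ordinal lti)); congr (X _ _); apply/val_inj.
Qed.

Definition SO3 (R : realType) (Q : 'M[R]_3) : Prop :=
  Q^T *m Q = 1%:M /\ \det Q = 1.

(* At Q in SO(3), a tangent vector U = Q *m hat u has vee (Q^T *m U) = u. *)
Definition so3_metric (R : realType) (Q U V : 'M[R]_3) : R :=
  ((vee (Q^T *m U))^T *m vee (Q^T *m V)) 0 0.

(* C^1 curves [0,1] -> SO(3), presented as restrictions to [0,1] of C^1 maps
   from the real line to the ambient matrix space. *)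
Definition so3_curve (R : realType) (P Q : 'M[R]_3) (g : R -> 'M[R]_3) : Prop :=
  [/\ forall t, derivable g t 1,
      continuous (derive1 g),
      forall t, 0 <= t <= 1 -> SO3 (g t),
      g 0 = P & g 1 = Q].

Definition so3_length (R : realType) (g : R -> 'M[R]_3) : R :=
  \int[lebesgue_measure]_(t in `[0, 1]%classic)
    Num.sqrt (so3_metric (g t) (derive1 g t) (derive1 g t)).

Definition geodist (R : realType) (P Q : 'M[R]_3) : R :=
  inf [set so3_length g | g in so3_curve P Q]%classic.

Definition expmx (R : realType) (X : 'M[R]_3) : 'M[R]_3 :=
  limn (fun n => \sum_(k < n) (k`!%:R)^-1 *: X ^+ k).

Definition principal_log (R : realType) (A X : 'M[R]_3) : Prop :=
  expmx X = A /\
  forall z : R[i],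
    eigenvalue (map_mx (real_complex R) X) z ->
    `|complex.Im z| < pi.

(* The principal logarithm is unique when it exists, that is, when A has no
   eigenvalue in ]-oo, 0]; otherwise logmx A = 0 is a dummy value. *)
Definition logmx (R : realType) (A : 'M[R]_3) : 'M[R]_3 :=
  xget 0 [set X | principal_log A X]%classic.

Definition sgnv (R : realType) (z : 'cV[R]_3) : 'cV[R]_3 :=
  if z == 0 then 0 else (enorm z)^-1 *: z.

(* Each undirected edge {i, j} is represented once, by the pair with i < j. *)
Definition edges (n : nat) (e : rel 'I_n) : {set 'I_n * 'I_n} :=
  [set p : 'I_n * 'I_n | (p.1 < p.2)%N && e p.1 p.2].

Definition is_tree (n : nat) (e : rel 'I_n) : Prop :=
  [/\ (0 < n)%N, forall i j, connect e i j & #|edges e| = n.-1].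

Definition err (R : realType) (n : nat) (x : 'I_n -> 'M[R]_3) (i j : 'I_n) :
  'cV[R]_3 := vee (logmx ((x i)^T *m x j)).

Definition total_error (R : realType) (n : nat) (e : rel 'I_n)
    (x : 'I_n -> 'M[R]_3) : R :=
  \sum_(p in edges e) enorm (err x p.1 p.2).

Definition neighbors (n : nat) (e : rel 'I_n) (i : 'I_n) : {set 'I_n} :=
  [set j | e i j].

Definition sgn_sum (R : realType) (n : nat) (e : rel 'I_n)
    (x : 'I_n -> 'M[R]_3) (i : 'I_n) : 'cV[R]_3 :=
  \sum_(j in neighbors e i) sgnv (err x i j).

Definition zero_rel (R : realType) (n : nat) (e : rel 'I_n)
    (x : 'I_n -> 'M[R]_3) : rel 'I_n :=
  [rel i j | e i j && (err x i j == 0)].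

Definition clusters (R : realType) (n : nat) (e : rel 'I_n)
    (x : 'I_n -> 'M[R]_3) : {set {set 'I_n}} :=
  equivalence_partition (connect (zero_rel e x)) [set: 'I_n].

Definition cluster_sum (R : realType) (n : nat) (e : rel 'I_n)
    (x : 'I_n -> 'M[R]_3) (C : {set 'I_n}) : 'cV[R]_3 :=
  \sum_(i in C) sgn_sum e x i.

(* Main.v *)
(* Contracting the clusters turns the tree into a graph whose edges are the
   edges with nonzero error.  A graph on n vertices has at least n minus its
   number of edges components, so with k clusters the zero-error edges number
   at least n - k and the nonzero ones at most k - 1.  Let D(C) be the number of
   ordered nonzero edges leaving a vertex of C.  Then D(C) >= 1 by
   connectedness, and |S_C| >= 2 - D(C): when D(C) = 1, S_C is a single unit
   vector.  Summing over C gives at least 2 k - 2 (k - 1) = 2.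
   Of the matrix logarithm only one property is used: err x i j vanishes iff
   err x j i does. *)

Require Import Defs.
From mathcomp Require Import all_boot all_order all_algebra.
From mathcomp Require Import all_classical all_reals all_analysis.
From mathcomp Require Import zify lra.

Set Implicit Arguments.
Unset Strict Implicit.
Unset Printing Implicit Defensive.

Import Order.TTheory GRing.Theory Num.Theory.
Import numFieldNormedType.Exports.

Local Open Scope ring_scope.

(** * Euclidean norm of normalised vectors *)

Lemma enorm_ge0 (R : realType) (v : 'cV[R]_3) : 0 <= enorm v.
Proof. exact: sqrtr_ge0. Qed.

Lemma enorm_sgnv (R : realType) (z : 'cV[R]_3) : z != 0 -> enorm (sgnv z) = 1.
Proof.
move=> z0; rewrite /sgnv (negPf z0) /enorm; set S := \sum_i z i 0 ^+ 2.
have S_gt0 : 0 < S.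
  rewrite lt_def sumr_ge0 => [|i _]; last exact: sqr_ge0.
  rewrite andbT; apply: contra z0 => /eqP/psumr_eq0P S0.
  apply/eqP/matrixP => i j; rewrite ord1 mxE; apply/eqP.
  by rewrite -sqrf_eq0 S0// => k _; exact: sqr_ge0.
rewrite (_ : \sum_i _ = 1) ?sqrtr1//.
under eq_bigr do rewrite mxE exprMn.
by rewrite -mulr_sumr exprVn sqr_sqrtr ?ltW// mulVf ?gt_eqF.
Qed.

(** * Transposition and the principal logarithm *)

Lemma char_poly_trmx (R : comNzRingType) (n : nat) (A : 'M[R]_n) :
  char_poly A^T = char_poly A.
Proof.
rewrite /char_poly -[RHS]det_tr; congr (\det _).
by apply/matrixP => i j; rewrite !mxE eq_sym.
Qed.

Lemma trmx_continuous (T : ptopologicalType) (m n : nat) :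
  continuous (@trmx T m n).
Proof.
move=> M A [P PM PA]; exists (fun i j => P j i) => [i j|N PN].
  by have := PM j i; rewrite mxE.
by apply: PA => i j; rewrite mxE; exact: PN.
Qed.

(** Transposition is continuous and involutive, so both sequences converge or neither does; in the
    latter case both limits are the default matrix, which transposition fixes. *)
Lemma lim_trmx (R : realType) (n : nat) (u : nat -> 'M[R]_n.+1) :
  limn (fun k => (u k)^T) = (limn u)^T.
Proof.
have tr_cvg v l : (v @ \oo --> l)%classic ->
    ((fun k => (v k)^T) @ \oo --> (l^T : 'M[R]_n.+1))%classic.
  by move=> vl; apply: (cvg_comp _ _ vl); exact: trmx_continuous.
have [uc|uN] := pselect (cvgn u).
  by apply/cvg_lim => //; exact: tr_cvg.
rewrite (dvgP uN) dvgP.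
  by apply/matrixP => i j; rewrite !mxE.
move=> uTc; apply: uN; apply/cvg_ex; exists ((limn (fun k => (u k)^T))^T).
have := tr_cvg _ _ uTc; rewrite (_ : (fun k => (u k)^T^T) = u)//.
by apply/funext => k; rewrite trmxK.
Qed.

Lemma expmx_tr (R : realType) (X : 'M[R]_3) : expmx X^T = (expmx X)^T.
Proof.
rewrite /expmx -lim_trmx; set u := fun n => _; set v := fun n => _^T.
suff -> : u = v by [].
apply/funext => n; rewrite /v raddf_sum; apply: eq_bigr => k _.
rewrite /= linearZ; congr (_ *: _).
elim: (k : nat) => [|m IHm]; first by rewrite !expr0 [RHS]trmx1.
by rewrite exprSr IHm exprS [RHS]trmx_mul.
Qed.

(** [X] and [X^T] share their characteristic polynomial, so the bound on the imaginary parts of the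
    eigenvalues carries over. *)
Lemma principal_log_tr (R : realType) (A X : 'M[R]_3) :
  principal_log A X -> principal_log A^T X^T.
Proof.
move=> [<- Xpi]; split => [|z]; first exact: expmx_tr.
by rewrite -map_trmx eigenvalue_root_char char_poly_trmx -eigenvalue_root_char;
  exact: Xpi.
Qed.

Lemma vee_eq0_sym (R : realType) (X : 'M[R]_3) : vee X = 0 -> X^T = X.
Proof.
move=> /matrixP v0.
have half (a b : R) : (a - b) / 2 = 0 -> a = b by lra.
have h0 := v0 0 0; have h1 := v0 1 0; have h2 := v0 2 0.
rewrite !mxE /= in h0 h1 h2.
move/half: h0 => h0; move/half: h1 => h1; move/half: h2 => h2.
apply/matrixP => i j; rewrite mxE.
have E (k : 'I_3) : [\/ k = 0, k = 1 | k = 2].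
  case: k => -[|[|[|//]]] ltk; [constructor 1|constructor 2|constructor 3];
  exact/val_inj.
by case: (E i) => ->; case: (E j) => ->.
Qed.

(* A zero error arises from the dummy value of [logmx], or from a symmetric
   logarithm, which forces A itself to be symmetric. *)
Lemma vee_logmx_tr_eq0 (R : realType) (A : 'M[R]_3) :
  vee (logmx A) = 0 -> vee (logmx A^T) = 0.
Proof.
have [[X lX]|noX] := pselect (exists X, principal_log A X).
  have [eA _] : principal_log A (logmx A).
    exact: (@xgetPex _ 0 [set X | principal_log A X]%classic (ex_intro _ X lX)).
  move=> v0; have AT : A^T = A by rewrite -eA -expmx_tr vee_eq0_sym.
  by rewrite AT.
move=> _; rewrite /logmx xgetPN; first by
  apply/matrixP => i j; rewrite !mxE !subrr !mul0r; case: i => -[|[|[|//]]].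
by move=> X /principal_log_tr; rewrite trmxK => lX; apply: noX; exists X^T.
Qed.

(** Swapping [i] and [j] transposes the matrix under the logarithm. *)
Lemma err_eq0_sym (R : realType) (n : nat) (x : 'I_n -> 'M[R]_3) (i j : 'I_n) :
  (err x i j == 0) = (err x j i == 0).
Proof.
have err0 k l : err x k l = 0 -> err x l k = 0.
  by move=> /vee_logmx_tr_eq0; rewrite trmx_mul trmxK.
by apply/eqP/eqP => /err0.
Qed.

(** * Components and edges of a finite graph *)

Lemma clusters_partition (n : nat) (f : rel 'I_n) (f_sym : symmetric f) :
  finset.partition (equivalence_partition (connect f) [set: 'I_n]) [set: 'I_n].
Proof.
apply/equivalence_partitionP => i j k _ _ _; split; first exact: connect0.
by move=> /(same_connect (sym_connect_sym f_sym)) ->.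
Qed.

(* Each vertex other than the root of its component is charged to the edge
   towards a neighbour strictly closer to the root; this is injective. *)
Lemma leq_card_components (n : nat) (f : rel 'I_n) (f_sym : symmetric f) :
  (n <= #|equivalence_partition (connect f) [set: 'I_n]| + #|edges f|)%N.
Proof.
have sc := sym_connect_sym f_sym.
(* Walks of length [k] from [v] to its root; [d v] is the least such length. *)
pose P v k := [exists p : k.-tuple 'I_n,
  path f v p && (last v p == fingraph.root f v)].
have exP v : exists k, P v k.
  have /connectP[p pp rp] := connect_root f v.
  exists (size p); apply/existsP; exists (in_tuple p).
  by rewrite /= pp rp eqxx.
pose d v := ex_minn (exP v).
have closer v : fingraph.root f v != v -> exists u, f v u && (d u < d v)%N.
  (* The first step of a shortest walk leads to [u], and the rest of the walk bounds [d u]. *)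
  rewrite {2}/d; case: ex_minnP => k /existsP[p /andP[pp lp]] _ vr.
  case: p pp lp => -[|u p] /= sp; first by move=> _; rewrite eq_sym (negPf vr).
  move=> /andP[vu up] lp; exists u; rewrite vu /=.
  rewrite /d; case: ex_minnP => m _ /(_ (size p)) mP.
  move: sp => /eqP <-; rewrite ltnS; apply: mP.
  apply/existsP; exists (in_tuple p); rewrite /= up (eqP lp).
  by apply/eqP/(fingraph.rootP sc); exact: connect1.
pose par v := odflt v [pick u | f v u && (d u < d v)%N].
have parP v : fingraph.root f v != v -> f v (par v) && (d (par v) < d v)%N.
  move=> /closer[u hu]; rewrite /par; case: pickP => [//|/(_ u)].
  by rewrite hu.
pose ed (v : 'I_n) := if (v < par v)%N then (v, par v) else (par v, v).
pose N := [set v | fingraph.root f v != v].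
have NE : (#|N| <= #|edges f|)%N.
  rewrite -(@card_in_imset _ _ ed N) => [|v w].
    apply/subset_leq_card/fintype.subsetP => _ /imsetP[v + ->].
    rewrite inE => /parP/andP[vp dp]; rewrite inE /ed.
    case: (ltngtP v (par v)) => /= [->//|->|/val_inj vp'].
      by rewrite f_sym.
    by rewrite -vp' ltnn in dp.
  (* Two distinct vertices charged to the same edge would be each other's parent, so each would be
     strictly closer to the root than the other. *)
  rewrite !inE => /parP/andP[_ dv] /parP/andP[_ dw]; rewrite /ed.
  case: ifP => _; case: ifP => _ [] // vE wE.
    by move: dv dw; rewrite wE -vE; lia.
  by move: dv dw; rewrite vE -wE; lia.
(* The complement of [N] consists of the roots, and distinct roots lie in distinct components. *)
have RE : (#|~: N| <= #|equivalence_partition (connect f) [set: 'I_n]|)%N.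
  pose comp r := [set y in [set: 'I_n] | connect f r y].
  rewrite -(@card_in_imset _ _ comp (~: N)).
    apply/subset_leq_card/fintype.subsetP => _ /imsetP[v _ ->].
    by apply/imsetP; exists v; rewrite ?inE.
  move=> r s; rewrite !inE !negbK => /eqP rr /eqP rs /setP/(_ s).
  by rewrite !inE connect0 => /(fingraph.rootP sc); rewrite rr rs.
by rewrite -[leqLHS](card_ord n) -(cardsC N) addnC leq_add.
Qed.

(** Swapping coordinates maps the pairs with [i < j] onto those with [j < i]; irreflexivity excludes
    the diagonal. *)
Lemma card_sym_rel (n : nat) (f : rel 'I_n) :
  symmetric f -> irreflexive f ->
  #|[set p : 'I_n * 'I_n | f p.1 p.2]| = #|edges f|.*2.
Proof.
move=> f_sym f_irr; pose sw (p : 'I_n * 'I_n) := (p.2, p.1).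
have sw_inj : injective sw by move=> [a b] [c d] [-> ->].
rewrite -addnn -[X in (_ + X)%N](card_imset _ sw_inj) -cardsUI.
rewrite (_ : edges f :&: _ = finset.set0) ?cards0 ?addn0; last first.
  apply/setP => -[i j]; rewrite !inE /=; apply/negP => /andP[/andP[ij _]].
  by case/imsetP => -[k l] + [? ?]; subst; rewrite inE /= => /andP[]; lia.
congr #|pred_of_set _|; apply/setP => -[i j]; rewrite !inE /=.
have -> : ((i, j) \in sw @: edges f) = (j < i)%N && f j i.
  by rewrite -[(i, j)]/(sw (j, i)) (mem_imset (edges f) _ sw_inj) inE.
case: (ltngtP i j) => [_|_|/val_inj ->] /=; first by rewrite orbF.
  by rewrite f_sym.
by rewrite f_irr.
Qed.

Theorem lemma4 (R : realType) (n : nat) (e : rel 'I_n)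
    (e_sym : symmetric e) (e_irr : irreflexive e) (e_tree : is_tree e)
    (x : 'I_n -> 'M[R]_3) (x_SO3 : forall i, SO3 (x i))
    (x_dist : forall i j, e i j -> geodist (x i) (x j) < pi)
    (W_gt0 : 0 < total_error e x) :
  2 <= \sum_(C in clusters e x) enorm (cluster_sum e x C).
Proof.
have [n_gt0 e_conn e_card] := e_tree.
pose z := zero_rel e x.
pose w : rel 'I_n := [rel i j | e i j && (err x i j != 0)].
have z_sym : symmetric z.
  by move=> i j; rewrite /z /zero_rel /= e_sym err_eq0_sym.
have w_sym : symmetric w by move=> i j; rewrite /w /= e_sym err_eq0_sym.
have w_irr : irreflexive w by move=> i; rewrite /w /= e_irr.
pose D (C : {set 'I_n}) := [set p : 'I_n * 'I_n | (p.1 \in C) && w p.1 p.2].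
have PC : finset.partition (clusters e x) [set: 'I_n].
  exact: clusters_partition z_sym.
have card_wz : (#|edges z| + #|edges w| = n.-1)%N.
  rewrite -e_card -(cardsID [set p | err x p.1 p.2 == 0] (edges e)).
  congr addn; apply: eq_card => -[i j]; rewrite !inE /=.
    by rewrite -!andbA.
  by rewrite [RHS]andbC -andbA.
have le_k : (n <= #|clusters e x| + #|edges z|)%N.
  exact: leq_card_components z_sym.
have w_gt0 : (0 < #|edges w|)%N.
  rewrite card_gt0; apply: contraTneq W_gt0 => w0.
  rewrite -leNgt /total_error big1 // => -[i j].
  rewrite inE /= => /andP[ij eij].
  have /setP/(_ (i, j)) := w0; rewrite !inE /w /= ij eij /= => /negbFE/eqP ->.
  by rewrite /enorm big1 ?sqrtr0// => k _; rewrite mxE expr0n.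
have sumD : (\sum_(C in clusters e x) #|D C| = #|edges w|.*2)%N.
  rewrite -(card_sym_rel w_sym w_irr) -sum1dep_card.
  rewrite -(pair_big_dep xpredT w (fun _ _ => 1%N))/=.
  transitivity (\sum_(i in [set: 'I_n]) \sum_(j | w i j) 1)%N; last first.
    by apply: eq_bigl => i; rewrite inE.
  rewrite (set_partition_big _ PC)/=; apply: eq_bigr => C _.
  by rewrite pair_big_dep/= sum1dep_card; apply: eq_card => p; rewrite !inE.
(* If no nonzero edge leaves a vertex of [C], then [C] is closed under [e], hence is the whole
   vertex set and the only cluster. The zero-error edges then number at least [n - 1], which leaves
   no room for a nonzero one. *)
have D_gt0 C : C \in clusters e x -> (0 < #|D C|)%N.
  move=> CP; rewrite card_gt0; apply/negP => /eqP D0.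
  have [C0 tI] : C != finset.set0 /\ finset.trivIset (clusters e x).
    by have /and3P[_ ? N0] := PC; split=> //; apply: contraNneq N0 => <-.
  have [i iC] := finset.set0Pn _ C0.
  have C_closed : fingraph.closed e C.
    apply: (intro_closed (sym_connect_sym e_sym)) => k l ekl kC.
    have kl0 : err x k l == 0.
      by move: D0 => /setP/(_ (k, l)); rewrite !inE /w /= kC ekl => /negbFE.
    have zc : connect z k l by apply: connect1; rewrite /z /zero_rel /= ekl.
    have eqz : {in [set: 'I_n] & &, equivalence_rel (connect z)}.
      move=> a b c _ _ _; split; first exact: connect0.
      by move=> /(same_connect (sym_connect_sym z_sym)) ->.
    rewrite -(def_pblock tI CP kC).
    by rewrite (pblock_equivalence_partition eqz).
  have CT : C = [set: 'I_n].
    apply/setP => j; rewrite inE -(closed_connect C_closed (e_conn i j)).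
    by rewrite iC.
  suff : (#|clusters e x| <= 1)%N.
    by move: le_k card_wz w_gt0 n_gt0; clear; lia.
  rewrite -(cards1 C); apply/subset_leq_card/fintype.subsetP => B BP.
  rewrite inE; apply/negPn/negP => BC.
  have /and3P[_ _ N0] := PC.
  have [B0|[j jB]] := set_0Vmem B; first by rewrite -B0 BP in N0.
  have /disjointFr/(_ jB) := finset.trivIsetP tI _ _ BP CP BC.
  by rewrite CT inE.
have lower C : C \in clusters e x -> 2 - #|D C|%:R <= enorm (cluster_sum e x C).
  move=> /D_gt0; case: (ltngtP #|D C| 1) => [|D2 _|D1 _]; first by lia.
    apply: le_trans (enorm_ge0 _); rewrite subr_le0 ler_nat//.
  have /eqP/cards1P[[i j] Dij] := D1.
  have : (i, j) \in D C by rewrite Dij inE.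
  rewrite inE /= => /andP[_ /andP[_ eij]].
  rewrite D1 -addrA subrr addr0 -(enorm_sgnv eij) /cluster_sum /sgn_sum.
  suff -> : \sum_(i in C) \sum_(j in neighbors e i) sgnv (err x i j)
      = sgnv (err x i j) by [].
  (* Zero-error pairs contribute [sgnv 0 = 0]; only the single pair in [D C] remains. *)
  rewrite pair_big_dep/= (bigID (fun p => w p.1 p.2))/= addrC big1 ?add0r.
    rewrite -[RHS](big_set1 +%R (i, j) (fun p => sgnv (err x p.1 p.2))) -Dij.
    apply: eq_bigl => -[k l]; rewrite !inE /w /=.
    by rewrite -andbA; case: (e k l).
  move=> [k l]; rewrite !inE /w /= => /andP[/andP[_ ->]] /= /negbNE.
  by rewrite /sgnv => ->.
apply: le_trans (ler_sum _ lower).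
(* With [k] clusters the bound is [2 * k - 2 * #|edges w|], and [le_k] with [card_wz] gives
   [k >= #|edges w| + 1]. *)
rewrite sumrB sumr_const -natr_sum sumD -mulrnA.
rewrite lerBrDr -natrD ler_nat; lia.
Qed.
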